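(* Let $G=(V,E)$ be a finite undirected unweighted graph with $V=\{1,\dots,n\}$, $n\ge2$, maximum degree $d_{\max}$, and vertex expansion $$\alpha=\min_{\emptyset\ne S\subsetneq V}\frac{|E(S,S^{c})|}{\min\{|S|,|S^{c}|\}}>0.$$ Then $$\|L^{\dagger}\|_{1\to1}\le\Big(4\ln\frac{n}{2}\Big)\cdot\Big(\alpha\ln\frac{2d_{\max}}{2d_{\max}-\alpha}\Big)^{-1}.$$
   Context: $E(S,S^c)$ is the set of edges with one endpoint in $S$ and the other in $S^c=V\setminus S$. $L$ is the graph Laplacian $L=B^{T}B$, where, for an arbitrary fixed orientation of the edges, $B\in\mathbb{R}^{E\times V}$ has row $e$ equal to $\chi_u-\chi_v$ for $e$ oriented $u\to v$ ($\chi_x$ the indicator vector of $x$); equivalently $L=D-A$ with $D$ the diagonal degree matrix and $A$ the adjacency matrix. $L^{\dagger}$ is the Moore–Penrose pseudoinverse of $L$, and $\|M\|_{1\to1}:=\sup_{x\neq0}\|Mx\|_1/\|x\|_1$.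
   Formalization: The formal theorem excludes n = 2 (so n ≥ 3): for n = 2 the only graph with α > 0 is a single edge, where the right-hand side is 0 since ln(n/2) = 0, while the norm of the pseudoinverse of L is 1/2, so the claim as printed fails there. *)

(* Defs.v *)
From HB Require Import structures.
From mathcomp Require Import all_boot all_order all_algebra.
From mathcomp Require Import all_classical all_reals all_analysis.
From mathcomp Require Import ring.

Set Implicit Arguments.
Unset Strict Implicit.
Unset Printing Implicit Defensive.

Import Order.TTheory GRing.Theory Num.Theory.

Local Open Scope ring_scope.

(* A simple graph on {0, ..., n-1} is a relation e : rel 'I_n, assumed        *)
(* symmetric and irreflexive where it matters.                                *)
Section Graph.
Variables (n : nat) (e : rel 'I_n).

Definition deg (v : 'I_n) : nat := #|[set w | e v w]|.

Definition max_deg : nat := \max_(v < n) deg v.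

(* Each edge of E(S, ~: S) occurs exactly once, as the ordered pair           *)
(* (endpoint in S, endpoint outside S).                                       *)
Definition edge_boundary (S : {set 'I_n}) : {set 'I_n * 'I_n} :=
  [set p | [&& p.1 \in S, p.2 \notin S & e p.1 p.2]].

Definition expansion_ratio (R : realType) (S : {set 'I_n}) : R :=
  #|edge_boundary S|%:R / (minn #|S| #|~: S|)%:R.

(* For 1 < n this infimum is a minimum: see vertex_expansion_min.             *)
Definition vertex_expansion (R : realType) : R :=
  inf [set expansion_ratio R S | S in
        [set S : {set 'I_n} | S != finset.set0 /\ S != finset.setT]]%classic.

Definition is_orientation (O : {set 'I_n * 'I_n}) : Prop :=
  (forall u v, e u v = ((u, v) \in O) || ((v, u) \in O)) /\
  (forall u v, (u, v) \in O -> (v, u) \notin O).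

Definition std_orientation : {set 'I_n * 'I_n} :=
  [set p | e p.1 p.2 && (p.1 < p.2)%N].

Definition incidence (R : realType) (O : {set 'I_n * 'I_n}) :
    'M[R]_(#|O|, n) :=
  \matrix_(k, v) (((enum_val k).1 == v)%:R - ((enum_val k).2 == v)%:R).

(* By incidence_gram below, any other orientation gives the same matrix.      *)
Definition laplacian (R : realType) : 'M[R]_n :=
  (incidence R std_orientation)^T *m incidence R std_orientation.

Definition degree_mx (R : realType) : 'M[R]_n := diag_mx (\row_v (deg v)%:R).

Definition adjacency_mx (R : realType) : 'M[R]_n := \matrix_(u, v) (e u v)%:R.

End Graph.

Section MoorePenrose.
Variables (R : realType) (m n : nat).

Definition is_moore_penrose (A : 'M[R]_(m, n)) (X : 'M[R]_(n, m)) : Prop :=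
  [/\ A *m X *m A = A, X *m A *m X = X,
      (A *m X)^T = A *m X & (X *m A)^T = X *m A].

(* Not to be confused with MathComp's pinvmx, which is a one-sided inverse on *)
(* the row space.  Existence and uniqueness are proved below, so the default  *)
(* value 0 is never used.                                                     *)
Definition moore_penrose (A : 'M[R]_(m, n)) : 'M[R]_(n, m) :=
  xget 0 [set X | is_moore_penrose A X]%classic.

End MoorePenrose.

Section Norm.
Variable R : realType.

Definition l1norm (n : nat) (x : 'cV[R]_n) : R := \sum_i `|x i 0|.

Definition l1_quotients (m n : nat) (M : 'M[R]_(m, n)) : set R :=
  [set l1norm (M *m x) / l1norm x | x in [set x : 'cV[R]_n | x != 0]]%classic.

(* The set of quotients is bounded (l1_quotients_ubound), so sup is genuine.  *)
Definition opnorm11 (m n : nat) (M : 'M[R]_(m, n)) : R := sup (l1_quotients M).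

End Norm.

Section GraphFacts.
Variables (n : nat) (e : rel 'I_n).

Lemma vertex_expansion_min (R : realType) : (1 < n)%N ->
  (exists S : {set 'I_n}, [/\ S != finset.set0, S != finset.setT &
     vertex_expansion e R = expansion_ratio e R S]) /\
  (forall S : {set 'I_n}, S != finset.set0 -> S != finset.setT ->
     vertex_expansion e R <= expansion_ratio e R S).
Proof.
move=> n1.
pose P := fun S : {set 'I_n} => (S != finset.set0) && (S != finset.setT).
pose i0 : 'I_n := Ordinal (ltn_trans (ltnSn 0) n1).
have P0 : P (finset.set1 i0).
  apply/andP; split; first by apply/set0Pn; exists i0; rewrite inE.
  apply/negP => /eqP /setP /(_ (Ordinal n1)).
  by rewrite !inE => /eqP /(congr1 val).
case: (@arg_minP _ R _ (finset.set1 i0) P (expansion_ratio e R) P0) => S PS Smin.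
have SE : vertex_expansion e R = expansion_ratio e R S.
  apply/eqP; rewrite eq_le; apply/andP; split.
    apply: ge_inf; last by exists S => //; exact/andP.
    exists (expansion_ratio e R S) => _ [T [T0 T1] <-]; apply: Smin.
    exact/andP.
  apply: lb_le_inf; first by exists (expansion_ratio e R S), S => //; exact/andP.
  by move=> _ [T [T0 T1] <-]; apply: Smin; exact/andP.
split; first by exists S; case/andP: PS => S0 S1; split.
by move=> T T0 T1; rewrite SE; apply: Smin; exact/andP.
Qed.

Lemma std_orientationP : symmetric e -> irreflexive e ->
  is_orientation e (std_orientation e).
Proof.
move=> sym irr; split=> u v; rewrite !inE /=.
  rewrite [e v u]sym -andb_orr.
  have [uv|uv|/val_inj ->] := ltngtP u v; rewrite ?andbT ?andbF //.
by move=> /andP[_ uv]; rewrite negb_and -leqNgt (ltnW uv) orbT.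
Qed.

Lemma incidence_gram (R : realType) (O : {set 'I_n * 'I_n}) :
  symmetric e -> irreflexive e -> is_orientation e O ->
  (incidence R O)^T *m incidence R O = degree_mx e R - adjacency_mx e R.
Proof.
move=> sym irr [eO OO]; apply/matrixP => u v; rewrite !mxE.
under eq_bigr do rewrite !mxE.
pose F (p : 'I_n * 'I_n) : R := ((p.1 == u)%:R - (p.2 == u)%:R) *
           ((p.1 == v)%:R - (p.2 == v)%:R).
rewrite (_ : \sum_ _ _ = \sum_(p in O) F p); last first.
  by rewrite [RHS]big_enum_val.
have -> : \sum_(p in O) F p =
    \sum_a \sum_(b | (a, b) \in O) F (a, b).
  by rewrite pair_big_dep /=; apply: eq_big => -[a b].
have FE a b : F (a, b) = ((a == u) && (a == v))%:R + ((b == u) && (b == v))%:R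
     - ((a == u) && (b == v))%:R - ((b == u) && (a == v))%:R.
  by rewrite /F mulrBl !mulrBr -!natrM !mulnb; ring.
under eq_bigr do under eq_bigr do rewrite FE.
have D1 (u0 v0 : 'I_n) :
   \sum_a \sum_(b | (a, b) \in O) ((a == u0) && (b == v0))%:R = ((u0, v0) \in O)%:R :> R.
  rewrite (bigD1 u0) //= [X in _ + X]big1 ?addr0 => [|a /negPf au]; last first.
    by rewrite big1 // => b _; rewrite au.
  rewrite big_mkcond (bigD1 v0) //= [X in _ + X]big1 ?addr0 => [|b /negPf bv]; last first.
    by rewrite bv andbF; case: ifP.
  by rewrite !eqxx; case: ifP.
have degE : (deg e u)%:R = \sum_b (((u, b) \in O)%:R + ((b, u) \in O)%:R) :> R.
  rewrite /deg -sum1_card natr_sum big_mkcond /=; apply: eq_bigr => b _.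
  rewrite inE eO; case E: ((u, b) \in O) => /=; last by rewrite add0r; case: ifP.
  by rewrite (negPf (OO _ _ E)) addr0.
under eq_bigr do rewrite !sumrB big_split /=.
rewrite !sumrB big_split /= D1 //.
under [X in _ - X]eq_bigr do under eq_bigr do rewrite andbC.
rewrite D1 // -addrA -opprD; congr (_ - _); last first.
  rewrite eO; case E: ((u, v) \in O) => /=; last by rewrite add0r.
  by rewrite (negPf (OO _ _ E)) addr0.
have [<-|/eqP uv] := eqVneq u v; last first.
  rewrite mulr0n big1 => [|a _]; last first.
    rewrite big1 // => b _; case: eqP => //= ->; by rewrite (introF eqP uv).
  rewrite add0r big1 // => a _.
  by rewrite big1 // => b _; case: eqP => //= ->; rewrite (introF eqP uv).
rewrite mulr1n degE big_split /=; congr (_ + _).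
  rewrite (bigD1 u) //= [X in _ + X]big1 ?addr0 => [|a /negPf au]; last first.
    by rewrite big1 // => b _; rewrite au.
  by rewrite big_mkcond; apply: eq_bigr => b _; rewrite eqxx; case: ifP.
apply: eq_bigr => a _; rewrite big_mkcond (bigD1 u) //=.
rewrite big1 ?addr0 => [|b /negPf bu]; last by rewrite bu; case: ifP.
by rewrite eqxx; case: ifP.
Qed.

Lemma laplacianE (R : realType) : symmetric e -> irreflexive e ->
  laplacian e R = degree_mx e R - adjacency_mx e R.
Proof.
by move=> sym irr; apply: incidence_gram => //; apply: std_orientationP.
Qed.

End GraphFacts.

Section MoorePenroseFacts.
Variable R : realType.

Lemma row_free_gram (m n : nat) (A : 'M[R]_(m, n)) :
  row_free A -> A *m A^T \in unitmx.
Proof.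
move=> fA; rewrite -row_free_unit; apply: inj_row_free => v.
move=> /(congr1 (mulmx^~ v^T)); rewrite mul0mx mulmxA -mulmxA -trmx_mul => E.
have vA0 : v *m A = 0.
  move: (v *m A) E => w /(congr1 (fun M : 'M[R]_1 => M 0 0)).
  rewrite mxE [RHS]mxE => /eqP; rewrite psumr_eq0 => [/allP w0|i _]; last first.
    by rewrite [X in _ * X]mxE sqr_ge0.
  apply/rowP => j; have := w0 j (mem_index_enum j).
  by rewrite !mxE mulf_eq0 orbb => /eqP.
by apply: (row_free_inj fA); rewrite vA0 mul0mx.
Qed.

Lemma moore_penrose_exists (m n : nat) (A : 'M[R]_(m, n)) :
  exists X, is_moore_penrose A X.
Proof.
have [r [C [W [-> UC UW]]]] : exists r (C : 'M[R]_(m, r)) (W : 'M[R]_(r, n)),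
    [/\ A = C *m W, C^T *m C \in unitmx & W *m W^T \in unitmx].
  exists (\rank A), (col_base A), (row_base A); split.
  - by rewrite mulmx_base.
  - rewrite -{2}[col_base A]trmxK; apply: row_free_gram.
    by rewrite /row_free mxrank_tr; exact: (col_base_full A).
  - by apply: row_free_gram; exact: row_base_free.
pose GW := invmx (W *m W^T); pose GC := invmx (C^T *m C).
have GWT : GW^T = GW by rewrite /GW trmx_inv trmx_mul trmxK.
have GCT : GC^T = GC by rewrite /GC trmx_inv trmx_mul trmxK.
pose X := W^T *m GW *m (GC *m C^T).
have AX : C *m W *m X = C *m GC *m C^T.
  rewrite /X -!mulmxA; congr (_ *m _).
  by rewrite (mulmxA W^T) (mulmxA W) (mulmxA W) mulmxV // mul1mx.
have XA : X *m (C *m W) = W^T *m GW *m W.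
  rewrite /X -!mulmxA; congr (_ *m (_ *m _)).
  by rewrite (mulmxA C^T) (mulmxA GC) mulVmx // mul1mx.
exists X; split.
- by rewrite AX -!mulmxA (mulmxA C^T) (mulmxA GC) mulVmx // mul1mx.
- rewrite XA /X -!mulmxA; congr (_ *m (_ *m _)).
  by rewrite (mulmxA W) (mulmxA (W *m _)) mulmxV // mul1mx.
- by rewrite AX !trmx_mul trmxK GCT mulmxA.
- by rewrite XA !trmx_mul trmxK GWT mulmxA.
Qed.

Lemma moore_penrose_unique (m n : nat) (A : 'M[R]_(m, n)) X Y :
  is_moore_penrose A X -> is_moore_penrose A Y -> X = Y.
Proof.
move=> [X1 X2 X3 X4] [Y1 Y2 Y3 Y4].
have AXY : A *m X = A *m Y.
  have E : A *m X = A *m Y *m (A *m X) by rewrite mulmxA Y1.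
  by rewrite -X3 E trmx_mul X3 Y3 mulmxA X1.
have XYA : X *m A = Y *m A.
  have E : X *m A = X *m A *m (Y *m A) by rewrite -mulmxA (mulmxA A) Y1.
  by rewrite -X4 E trmx_mul X4 Y4 -mulmxA (mulmxA A) X1.
by rewrite -X2 -mulmxA AXY mulmxA XYA Y2.
Qed.

Lemma moore_penroseP (m n : nat) (A : 'M[R]_(m, n)) :
  is_moore_penrose A (moore_penrose A).
Proof.
have [X HX] := moore_penrose_exists A.
exact: (@xgetPex _ 0 [set X | is_moore_penrose A X]%classic (ex_intro _ X HX)).
Qed.

End MoorePenroseFacts.

Section NormFacts.
Variable R : realType.

Lemma l1norm_gt0 (n : nat) (x : 'cV[R]_n) : x != 0 -> 0 < l1norm x.
Proof.
move=> x0; rewrite lt_neqAle sumr_ge0 // andbT eq_sym.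
apply: contra x0; rewrite psumr_eq0 // => /allP H; apply/eqP/colP => i.
rewrite mxE; apply/eqP; rewrite -normr_eq0.
exact: (H i (mem_index_enum i)).
Qed.

Lemma l1_quotients_ubound (m n : nat) (M : 'M[R]_(m, n)) :
  has_ubound (l1_quotients M).
Proof.
exists (\sum_i \sum_j `|M i j|) => _ [x x0 <-].
rewrite ler_pdivrMr ?l1norm_gt0 // /l1norm mulr_suml; apply: ler_sum => i _.
rewrite mxE mulr_suml; apply: (le_trans (ler_norm_sum _ _ _)).
apply: ler_sum => j _; rewrite normrM ler_wpM2l //.
by rewrite (bigD1 j) //= lerDl sumr_ge0.
Qed.

Lemma opnorm11_gt0 (m n : nat) (M : 'M[R]_(m, n)) : M != 0 -> 0 < opnorm11 M.
Proof.
case/matrix0Pn => i [j Mij].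
pose x : 'cV[R]_n := delta_mx j 0.
have x0 : x != 0 by apply/matrix0Pn; exists j, 0; rewrite !mxE !eqxx oner_eq0.
have Mx0 : M *m x != 0.
  by rewrite -colE; apply/matrix0Pn; exists i, 0; rewrite mxE.
apply: (@lt_le_trans _ _ (l1norm (M *m x) / l1norm x)).
  by rewrite divr_gt0 ?l1norm_gt0.
by apply: ub_le_sup; [exact: l1_quotients_ubound | exists x].
Qed.

End NormFacts.

(* For two vertices the bound in terms of ln (n / 2) is false: it reads       *)
(* opnorm11 _ <= 0, while the complete graph on two vertices has expansion 1  *)
(* and a nonzero Laplacian.                                                   *)
Lemma two_vertices_counterexample (R : realType) :
  let e : rel 'I_2 := fun u v => u != v in
  let a := vertex_expansion e R in
  let d : R := (max_deg e)%:R in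
  [/\ symmetric e, irreflexive e, 0 < a &
      ~ opnorm11 (moore_penrose (laplacian e R)) <=
        (4 * ln (2%:R / 2)) * (a * ln ((2 * d) / (2 * d - a)))^-1].
Proof.
move=> e a d.
have sym : symmetric e by move=> u v; rewrite /e eq_sym.
have irr : irreflexive e by move=> u; rewrite /e eqxx.
split=> //.
  have [[S [/set0Pn[u uS] ST SE]] _] := vertex_expansion_min e R (ltnSn 1).
  have [v vS] : exists v, v \notin S.
    apply/existsP; apply: contraR ST => /existsPn H; apply/eqP/setP => v.
    by rewrite inE; apply/negPn/H.
  rewrite /a SE divr_gt0 // ltr0n.
    apply/card_gt0P; exists (u, v); rewrite inE /= uS vS /e.
    by apply: contraNneq vS => <-.
  rewrite leq_min; apply/andP; split; apply/card_gt0P; first by exists u.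
  by exists v; rewrite inE.
apply/negP; rewrite -ltNge divff ?pnatr_eq0 // ln1 mulr0 mul0r.
apply: opnorm11_gt0; apply/eqP => X0.
have [] := moore_penroseP (laplacian e R); rewrite X0 mulmx0 mul0mx => L0 _ _ _.
have := congr1 (fun M : 'M[R]_2 => M ord0 ord_max) L0.
rewrite laplacianE // !mxE /e /= => /eqP.
by rewrite mulr0n sub0r eq_sym oppr_eq0 oner_eq0.
Qed.

(* Main.v *)
(* Only columns of the pseudoinverse matter.  Column s is a mean-zero potential y
   with L y = chi_s - 1/n, so its l1 norm is twice the sum of its positive parts,
   or of its negative parts; take the sign having k <= n/2 vertices.  The flow
   leaving a superlevel set of size k <= n/2 is at most 1 - k/n, while the cut has
   at least alpha k edges, so raising the level by 2 (1 - k/n) / (alpha k) costs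
   (2/alpha) (1 - k/n) and shrinks the set by the factor 1 - alpha / (2 dmax).
   With lam = - ln (1 - alpha / (2 dmax)), induction on k bounds the sum by
   (2/alpha) (ln k / lam + 1 - 2k/n).  The last term, which comes from the factor
   1 - k/n in the flow, absorbs the rounding up of the number of steps: at k = n/2
   the bound is exactly (2/alpha) ln (n/2) / lam. *)
Require Import Defs.
From mathcomp Require Import all_boot all_order all_algebra.
From mathcomp Require Import all_classical all_reals all_analysis.
From mathcomp Require Import ring lra zify.

Import Order.TTheory GRing.Theory Num.Theory.

Local Open Scope ring_scope.

Set Implicit Arguments.
Unset Strict Implicit.

(** * Logarithm estimates *)

Lemma lnB_ge (R : realType) (x y : R) : 0 < x -> 0 < y ->
  1 - y / x <= ln x - ln y.
Proof.
move=> x0 y0; have yx0 : 0 < y / x by rewrite divr_gt0.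
have : ln (1 + (y / x - 1)) <= y / x - 1 by apply: le_ln1Dx; lra.
rewrite addrC subrK ln_div ?posrE //; lra.
Qed.

(** Monotonicity of [z |-> ln z - l * (2 * z / N)] up to [N / 2]: there the derivative [1 / z] of
    [ln] is at least [2 / N]. It lets a bound at an integer cardinality be replaced by one at a
    larger real number. *)
Lemma lnB_ge_scaled (R : realType) (x y N l : R) : 0 < y -> y <= x ->
  2 * x <= N -> 0 <= l -> l <= 1 -> l * (2 * (x - y) / N) <= ln x - ln y.
Proof.
move=> y0 yx xN l0 l1; have x0 : 0 < x by lra.
apply: le_trans (lnB_ge x0 y0).
have -> : 1 - y / x = (x - y) / x by rewrite mulrBl divff ?gt_eqF.
have N0 : 0 < N by lra.
apply: (@le_trans _ _ (2 * (x - y) / N)).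
  by apply: ler_piMl => //; rewrite divr_ge0 ?mulr_ge0 //; lra.
have xy0 : 0 <= (x - y) / x by rewrite divr_ge0 //; lra.
have := ler_wpM2l xy0 xN; rewrite ler_pdivrMr //; apply: le_trans.
by rewrite mulrCA divfK ?gt_eqF.
Qed.

(** * Mass of a function above a level *)

(** Equals the integral, over levels above [t], of the size of the superlevel set; at [t = 0] it is
    the sum of the positive parts. *)
Definition excess (R : realType) (n : nat) (y : 'I_n -> R) (t : R) : R :=
  \sum_(u | t < y u) (y u - t).

Lemma excess_shift (R : realType) (n : nat) (y : 'I_n -> R) t d : 0 <= d ->
  excess y t <= excess y (t + d) + #|[set u | t < y u]|%:R * d.
Proof.
move=> d0; rewrite mulr_natl -sumr_const /excess.
rewrite [X in _ + X](eq_bigl (fun u => t < y u)); last by move=> u; rewrite inE.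
rewrite [X in X + _](big_mkcond) /= [X in _ + X](big_mkcond) /= -big_split /=.
rewrite big_mkcond /=; apply: ler_sum => u _.
by case: ifP; case: ifP; lra.
Qed.

Lemma sum_norm_excess (R : realType) (n : nat) (y : 'I_n -> R) :
  \sum_u y u = 0 -> \sum_u `|y u| = 2 * excess y 0.
Proof.
move=> y0.
suff : \sum_u `|y u| = 2 * excess y 0 - \sum_u y u by rewrite y0 subr0.
rewrite /excess mulr_sumr [X in X - _]big_mkcond -sumrB; apply: eq_bigr => u _.
by case: ltP => u0; [rewrite gtr0_norm | rewrite ler0_norm] => //; lra.
Qed.

Lemma excessN (R : realType) (n : nat) (y : 'I_n -> R) :
  \sum_u y u = 0 -> excess (fun u => - y u) 0 = excess y 0.
Proof.
move=> y0; have yN0 : \sum_u - y u = 0 by rewrite sumrN y0 oppr0.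
have := sum_norm_excess y0; have := sum_norm_excess yN0.
under eq_bigr do rewrite normrN.
by move=> ->; lra.
Qed.

(** * Flow through superlevel sets *)

Section Graph.
Variables (R : realType) (n : nat) (e : rel 'I_n).

Definition net_flow (y : 'I_n -> R) (S : {set 'I_n}) : R :=
  \sum_(u in S) \sum_(v | e u v) (y u - y v).

Definition outdeg (S : {set 'I_n}) (u : 'I_n) : nat :=
  #|[set v | e u v & v \notin S]|.

Lemma sum_outdeg (S : {set 'I_n}) :
  (\sum_(u in S) outdeg S u = #|edge_boundary e S|)%N.
Proof.
rewrite -sum1_card.
under eq_bigr => u _ do rewrite /outdeg -sum1_card.
rewrite pair_big_dep /=; apply: eq_bigl => -[u v].
by rewrite !inE /= [e u v && _]andbC.
Qed.

Lemma leq_outdeg (S : {set 'I_n}) u : (outdeg S u <= max_deg e)%N.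
Proof.
apply: (@leq_trans (deg e u)); last exact: (leq_bigmax u).
by apply: subset_leq_card; apply/fintype.subsetP => v; rewrite !inE => /andP[].
Qed.

Hypothesis e_sym : symmetric e.

(** Edges inside [S] are counted in both directions with opposite signs, so their contribution [I]
    satisfies [I = - I]. *)
Lemma net_flowE (y : 'I_n -> R) (S : {set 'I_n}) :
  net_flow y S = \sum_(u in S) \sum_(v | e u v && (v \notin S)) (y u - y v).
Proof.
rewrite /net_flow; under eq_bigr => u _ do rewrite (bigID (mem S)) /=.
rewrite big_split /= -[RHS]add0r; congr (_ + _).
set I := LHS; suff : I = - I by move=> ?; lra.
rewrite {2}/I -sumrN {1}/I.
rewrite (exchange_big_dep (mem S)) /=; last by move=> u v _ /andP[].
apply: eq_bigr => v vS; rewrite -sumrN; apply: eq_big => u.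
  by rewrite vS andbT andbC e_sym.
by rewrite opprB.
Qed.

(** An edge leaving the superlevel set ends at or below [t], so the drop along it is at least
    [y u - t]. *)
Lemma net_flow_superlevel (y : 'I_n -> R) t (S := [set u | t < y u]) :
  \sum_(u in S) (outdeg S u)%:R * (y u - t) <= net_flow y S.
Proof.
rewrite net_flowE; apply: ler_sum => u; rewrite inE => tu.
rewrite mulr_natl /outdeg -sumr_const big_mkcond [leRHS]big_mkcond /=.
apply: ler_sum => v _; rewrite inE; case: ifP => // /andP[_].
by rewrite inE -leNgt => vt; rewrite lerB.
Qed.

Hypothesis n_gt1 : (1 < n)%N.

Lemma edge_boundary_ge (S : {set 'I_n}) : (0 < #|S|)%N -> (#|S|.*2 <= n)%N ->
  vertex_expansion e R * #|S|%:R <= #|edge_boundary e S|%:R.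
Proof.
move=> S0 Sn; have [_ /(_ S)] := vertex_expansion_min e R n_gt1.
have CS := cardsC S; rewrite card_ord in CS.
rewrite -card_gt0 S0 => /(_ isT); rewrite /expansion_ratio.
rewrite (minn_idPl _) ?ler_pdivlMr ?ltr0n //; last by lia.
apply; apply: contraTneq Sn => ->; rewrite cardsT card_ord; lia.
Qed.

(** Expansion is tested on a singleton. With [alpha] positive, this keeps [2 * dmax - alpha]
    positive. *)
Lemma vertex_expansion_le_max_deg : vertex_expansion e R <= (max_deg e)%:R.
Proof.
pose u := Ordinal n_gt1.
have := @edge_boundary_ge [set u]; rewrite cards1 mulr1 -sum_outdeg big_set1.
move=> /(_ isT n_gt1) /le_trans; apply; rewrite ler_nat; exact: leq_outdeg.
Qed.


(** * Geometric decay of superlevel sets and the resulting bound on the excess *)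

Section Excess.

Let alpha : R := vertex_expansion e R.
Let dmax : R := (max_deg e)%:R.

Hypothesis alpha_gt0 : 0 < alpha.

Let lam : R := ln (2 * dmax / (2 * dmax - alpha)).

(** The upper bound restates [alpha <= dmax]; through [ln 2 <= 1] it gives the factor [l <= 1] that
    [lnB_ge_scaled] requires. *)
Lemma log_rate_bounds : 0 < lam <= ln 2.
Proof.
have ad : alpha <= dmax := vertex_expansion_le_max_deg.
have p0 : 0 < 2 * dmax - alpha by have := alpha_gt0; lra.
have a0 := alpha_gt0.
rewrite /lam; apply/andP; split.
  by apply: ln_gt0; rewrite ltr_pdivlMr // mul1r; lra.
rewrite ler_ln ?posrE ?ltr0n //; last by rewrite divr_gt0 //; lra.
by rewrite ler_pdivrMr //; lra.
Qed.

Lemma ln2_le1 : ln 2 <= 1 :> R.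
Proof. by have := @le_ln1Dx R 1; rewrite -[1 + 1]/(2%:R); apply; lra. Qed.

Variable y : 'I_n -> R.
(** A one-sided bound, so that both a column of the pseudoinverse and its negative satisfy it. *)
Hypothesis y_flow : forall S : {set 'I_n}, (#|S|.*2 <= n)%N ->
  net_flow y S <= 1 - #|S|%:R / n%:R.

(* Markov's inequality for the potential drops along the cut at level t: at
   least half of the cut edges start at vertices at or below level t + d. *)
Lemma card_superlevel_shift t (S := [set u | t < y u]) (k : R := #|S|%:R)
    (d := 2 * (1 - k / n%:R) / (alpha * k)) :
  (0 < #|S|)%N -> (#|S|.*2 <= n)%N ->
  #|[set u | t + d < y u]|%:R * (2 * dmax) <= k * (2 * dmax - alpha).
Proof.
move=> S0 Sn; set S' := [set u | t + d < y u].
have k0 : 0 < k by rewrite ltr0n.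
have n0 : 0 < n%:R :> R by rewrite ltr0n; lia.
have kn : 2 * k <= n%:R by rewrite -natrM ler_nat; lia.
have kn1 : 0 < 1 - k / n%:R by rewrite subr_gt0 ltr_pdivrMr //; lra.
have d0 : 0 < d by rewrite divr_gt0 ?mulr_gt0.
have S'S : S' \subset S.
  by apply/fintype.subsetP => u; rewrite !inE; have := d0; lra.
have flow := le_trans (net_flow_superlevel y t) (y_flow Sn).
have bnd := edge_boundary_ge S0 Sn.
rewrite -sum_outdeg natr_sum in bnd.
rewrite -/S (big_setID S') /= in flow.
rewrite (big_setID S') /= in bnd.
rewrite (finset.setIidPr S'S) in flow bnd.
have D0 : 0 <= \sum_(u in S :\: S') (outdeg S u)%:R * (y u - t).
  by apply: sumr_ge0 => u; rewrite !inE => /andP[_ tu]; rewrite mulr_ge0 //; lra.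
have D1 : (\sum_(u in S') (outdeg S u)%:R) * d <=
    \sum_(u in S') (outdeg S u)%:R * (y u - t).
  rewrite mulr_suml; apply: ler_sum => u; rewrite inE => tu.
  by rewrite ler_wpM2l //; lra.
have D2 : \sum_(u in S') (outdeg S u)%:R <= alpha * k / 2.
  rewrite -(ler_pM2r d0); apply: (le_trans D1).
  have -> : alpha * k / 2 * d = 1 - k / n%:R.
    by rewrite /d; field; rewrite !gt_eqF.
  by lra.
have D3 : \sum_(u in S :\: S') (outdeg S u)%:R <= (k - #|S'|%:R) * dmax.
  have -> : k - #|S'|%:R = #|S :\: S'|%:R.
    by rewrite /k -(cardsID S' S) (finset.setIidPr S'S) natrD; lra.
  rewrite mulr_natl -sumr_const; apply: ler_sum => u _.
  by rewrite ler_nat leq_outdeg.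
(* At most half of the guaranteed [alpha * k] cut edges start in [S']; the others need at least
   [alpha * k / (2 * dmax)] vertices in [S :\: S']. *)
have : alpha * k <= alpha * k / 2 + (k - #|S'|%:R) * dmax.
  by apply: (le_trans bnd); rewrite lerD.
by lra.
Qed.

Hypothesis n_gt2 : (2 < n)%N.

Lemma excess_le t (k := #|[set u | t < y u]|) : (0 < k)%N -> (k.*2 <= n)%N ->
  alpha * lam * excess y t <= 2 * (ln k%:R + lam * (1 - 2 * k%:R / n%:R)).
Proof.
rewrite {}/k; move Ek : #|_| => k; elim/ltn_ind: k t Ek => k IH t Ek kgt0 kn2.
have [lam0 lamle] := andP log_rate_bounds.
have ln21 := ln2_le1.
have a0 := alpha_gt0.
have ad : alpha <= dmax := vertex_expansion_le_max_deg.
have k0 : 0 < k%:R :> R by rewrite ltr0n.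
have n0 : 0 < n%:R :> R by rewrite ltr0n; lia.
have kn : 2 * k%:R <= n%:R :> R by rewrite -natrM ler_nat; lia.
have kn1 : k%:R / n%:R <= 1 / 2 :> R by rewrite ler_pdivrMr //; lra.
pose d := 2 * (1 - k%:R / n%:R) / (alpha * k%:R).
have d0 : 0 <= d by rewrite divr_ge0 ?mulr_ge0 //; lra.
have := @excess_shift R n y t d d0; rewrite Ek.
have -> : k%:R * d = 2 * (1 - k%:R / n%:R) / alpha.
  by rewrite /d; field; rewrite !gt_eqF.
move=> sh.
have {}sh : alpha * lam * excess y t <=
    alpha * lam * excess y (t + d) + 2 * lam * (1 - k%:R / n%:R).
  have -> : 2 * lam * (1 - k%:R / n%:R) =
      alpha * lam * (2 * (1 - k%:R / n%:R) / alpha).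
    by field; rewrite !gt_eqF.
  by rewrite -mulrDr ler_wpM2l // mulr_ge0 // ltW.
have /= := @card_superlevel_shift t; rewrite Ek -/d => /(_ kgt0 kn2).
move Ek' : #|_| => k' Hk'.
have [k'0|k'gt0] := posnP k'.
  have E0 : excess y (t + d) = 0.
    rewrite /excess big_pred0 // => u; move: k'0; rewrite -Ek' => /eqP.
    by rewrite cards_eq0 => /eqP/setP/(_ u); rewrite !inE.
  rewrite E0 mulr0 add0r in sh.
  (* Nothing lies above [t + d]. For [k >= 2] the term [ln k] is at least [ln 2] and covers the
     deficit [lam * (k / n)]. *)
  have [k1|k1] := leqP 2 k.
    apply: (le_trans sh).
    have : ln 2 <= ln k%:R :> R by rewrite ler_ln ?posrE ?ltr0n ?ler_nat.
    by have := ler_wpM2l (ltW lam0) kn1; rewrite -mulrA; lra.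
  (* For [k = 1] the logarithm vanishes and a step of length [d] is too costly. All cut edges now
     start at the single vertex [s], so the flow bound applies without Markov's factor 2; what
     remains is [3 / n <= 1]. *)
  have {}k1 : k = 1%N by apply/eqP; rewrite eqn_leq kgt0 -ltnS k1.
  move: Ek; rewrite k1 => /eqP/cards1P[s Es].
  have /= fl := net_flow_superlevel y t.
  have fl' : net_flow y [set u | t < y u] <= 1 - 1 / n%:R.
    by have := @y_flow [set u | t < y u]; rewrite Es cards1; apply; exact: ltnW.
  have bd : alpha <= (outdeg [set s] s)%:R.
    have := @edge_boundary_ge [set s]; rewrite cards1 mulr1 -sum_outdeg big_set1.
    by apply => //; exact: ltnW.
  rewrite Es big_set1 in fl fl' *.
  have ets : excess y t = y s - t.
    rewrite /excess (eq_bigl (mem [set s])) ?big_set1 // => u.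
    by rewrite -[RHS]/(u \in [set s]) -Es inE.
  have st : t < y s by have := set11 s; rewrite -Es inE.
  have E1 : alpha * (y s - t) <= 1 - 1 / n%:R.
    apply: le_trans fl'; apply: le_trans fl; rewrite ler_wpM2r //; lra.
  have n3 : 3 / n%:R <= 1 :> R by rewrite ler_pdivrMr // mul1r ler_nat.
  rewrite ets ln1 add0r.
  have := ler_wpM2r (ltW lam0) E1; have := ler_wpM2r (ltW lam0) n3; lra.
have d2 : 0 < 2 * dmax by lra.
have k'k : (k' < k)%N.
  rewrite -(ltr_nat R) -(ltr_pM2r d2); apply: (le_lt_trans Hk').
  by rewrite ltr_pM2l //; lra.
have k'n2 : (k'.*2 <= n)%N by rewrite (leq_trans _ kn2) // leq_double ltnW.
have IHk := IH k' k'k (t + d) Ek' k'gt0 k'n2.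
(* The real-valued bound on [k'], at which the logarithm has dropped by exactly [lam]. *)
pose c : R := k%:R * ((2 * dmax - alpha) / (2 * dmax)).
have r0 : 0 < (2 * dmax - alpha) / (2 * dmax) by rewrite divr_gt0 //; lra.
have lnc : ln c = ln k%:R - lam.
  by rewrite /c lnM ?posrE // /lam -invf_div lnV ?posrE // -invr_gt0 invf_div.
have ck' : k'%:R <= c by rewrite /c mulrA ler_pdivlMr.
have ck : c <= k%:R.
  rewrite /c; apply: ler_piMr; first exact: ltW.
  by rewrite ler_pdivrMr // mul1r; lra.
have kc : k%:R <= 2 * c.
  rewrite /c mulrCA; apply: ler_peMr; first exact: ltW.
  by rewrite mulrA ler_pdivlMr // mul1r; lra.
have k'0 : 0 < k'%:R :> R by rewrite ltr0n.
have cn : 2 * c <= n%:R by lra.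
have lam1 : lam <= 1 := le_trans lamle ln21.
(* Passing from [k'] to [c] turns the correction into [1 - 2 * c / n]; since [k <= 2 * c], adding
   the cost [1 - k / n] of the step gives at most [1 + (1 - 2 * k / n)], and the 1 is paid by
   [lnc]. *)
have := lnB_ge_scaled k'0 ck' cn (ltW lam0) lam1.
have : lam * (k%:R / n%:R) <= lam * (2 * c / n%:R).
  by rewrite ler_pM2l // ler_wpM2r // invr_ge0 ltW.
rewrite lnc; lra.
Qed.

(** The bound of [excess_le] grows with [k] up to [n / 2], where its correction term vanishes. *)
Lemma excess0_le (k := #|[set u | 0 < y u]|) : (k.*2 <= n)%N ->
  excess y 0 <= 2 * ln (n%:R / 2) * (alpha * lam)^-1.
Proof.
have [lam0 lamle] := andP log_rate_bounds.
have ln21 := ln2_le1; have a0 := alpha_gt0.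
move=> kn2; rewrite ler_pdivlMr ?mulr_gt0 // [leLHS]mulrC.
have n0 : 0 < n%:R :> R by rewrite ltr0n; lia.
have [k0|kgt0] := posnP k.
  rewrite /excess big_pred0 ?mulr0; last first.
    by move=> u; move/eqP: k0; rewrite cards_eq0 => /eqP/setP/(_ u); rewrite !inE.
  rewrite mulr_ge0 // ln_ge0 // ler_pdivlMr // mul1r ler_nat; lia.
have kn : 2 * k%:R <= n%:R :> R by rewrite -natrM ler_nat; lia.
apply: (le_trans (excess_le kgt0 kn2)); rewrite -/k ler_pM2l //.
have k0 : 0 < k%:R :> R by rewrite ltr0n.
have kn' : k%:R <= n%:R / 2 :> R by lra.
have nn : 2 * (n%:R / 2) <= n%:R :> R by lra.
have lam1 : lam <= 1 := le_trans lamle ln21.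
have := lnB_ge_scaled k0 kn' nn (ltW lam0) lam1.
have -> : 2 * (n%:R / 2 - k%:R) / n%:R = 1 - 2 * k%:R / n%:R :> R.
  by field; rewrite gt_eqF.
lra.
Qed.

End Excess.

End Graph.

(** * The Laplacian and its pseudoinverse *)

Section Laplacian.
Variables (R : realType) (n : nat) (e : rel 'I_n).
Hypotheses (e_sym : symmetric e) (e_irr : irreflexive e).

Let L := laplacian e R.

Lemma laplacian_mulE (x : 'cV[R]_n) u :
  (L *m x) u 0 = \sum_(v | e u v) (x u 0 - x v 0).
Proof.
rewrite /L laplacianE // mulmxBl mul_diag_mx !mxE sumrB sumr_const mulr_natl.
congr (_ *+ _ - _); first by apply: eq_card => v; rewrite inE.
rewrite [RHS]big_mkcond; apply: eq_bigr => v _; rewrite mxE.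
by case: ifP; rewrite ?mul1r ?mul0r.
Qed.

Lemma net_flow_laplacian (x : 'cV[R]_n) (S : {set 'I_n}) :
  net_flow e (fun u => x u 0) S = \sum_(u in S) (L *m x) u 0.
Proof. by apply: eq_bigr => u _; rewrite laplacian_mulE. Qed.

Lemma net_flowN (y : 'I_n -> R) (S : {set 'I_n}) :
  net_flow e (fun u => - y u) S = - net_flow e y S.
Proof.
rewrite /net_flow -sumrN; apply: eq_bigr => u _; rewrite -sumrN.
by apply: eq_bigr => v _; lra.
Qed.

Lemma laplacian_tr : L^T = L.
Proof. by rewrite /L /laplacian trmx_mul trmxK. Qed.

Lemma laplacian_const (c : R) : L *m const_mx c = 0 :> 'cV_n.
Proof.
apply/colP => u; rewrite laplacian_mulE [RHS]mxE big1 // => v _.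
by rewrite !mxE subrr.
Qed.

Hypotheses (n_gt1 : (1 < n)%N) (alpha_gt0 : 0 < vertex_expansion e R).

Lemma edge_boundary_neq0 (S : {set 'I_n}) : S != finset.set0 ->
  S != finset.setT -> exists u v, [/\ u \in S, v \notin S & e u v].
Proof.
move=> S0 ST; have [_ /(_ S S0 ST)] := vertex_expansion_min e R n_gt1.
move=> /(lt_le_trans alpha_gt0); rewrite /expansion_ratio.
have [/eqP|/card_gt0P[[u v]]] := posnP #|edge_boundary e S|.
  by move=> /eqP ->; rewrite mul0r ltxx.
by rewrite inE /= => /and3P[uS vS uv] _; exists u, v.
Qed.

(** If [x] took two values, the superlevel set at the lower one would be proper and nonempty;
    expansion gives an edge leaving it, hence a positive flow, while [L *m x = 0] makes the flow
    zero. *)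
Lemma ker_laplacian_const (x : 'cV[R]_n) : L *m x = 0 ->
  forall u v, x u 0 = x v 0.
Proof.
move=> Lx0.
suff le_x u v : x u 0 <= x v 0 by move=> u v; apply/eqP; rewrite eq_le !le_x.
rewrite leNgt; apply/negP => vu.
pose y w := x w 0; pose S := [set w | y v < y w].
have S0 : S != finset.set0 by apply/set0Pn; exists u; rewrite inE.
have ST : S != finset.setT.
  by apply/eqP => /setP/(_ v); rewrite !inE ltxx.
have [a [b [aS bS ab]]] := edge_boundary_neq0 S0 ST.
have /= := net_flow_superlevel e_sym y (y v).
rewrite -/S [net_flow e y S]net_flow_laplacian Lx0.
rewrite [leRHS]big1 => [|w _]; last by rewrite mxE.
apply/negP; rewrite -ltNge (bigD1 a) //= ltr_wpDr //.
  by apply: sumr_ge0 => w /andP[]; rewrite inE => ? _; rewrite mulr_ge0 //; lra.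
rewrite mulr_gt0 //; last by rewrite subr_gt0; move: aS; rewrite inE.
by rewrite ltr0n; apply/card_gt0P; exists b; rewrite inE ab.
Qed.

Let X := moore_penrose L.

Lemma tr_const_mulE (M : 'M[R]_n) s :
  ((const_mx 1 : 'cV[R]_n)^T *m M) 0 s = \sum_u M u s.
Proof. by rewrite mxE; apply: eq_bigr => u _; rewrite !mxE mul1r. Qed.

Lemma tr_const_laplacian : (const_mx 1 : 'cV[R]_n)^T *m L = 0.
Proof. by rewrite -laplacian_tr -trmx_mul laplacian_const trmx0. Qed.

(** Symmetry of [X *m L] puts the columns of [X] in the range of [L], which is orthogonal to
    constants. *)
Lemma sum_col_moore_penrose s : \sum_u X u s = 0.
Proof.
have [_ X2 _ X4] : is_moore_penrose L X := moore_penroseP L.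
have XE : X = L *m (X^T *m X).
  by rewrite -{1}X2 -X4 trmx_mul laplacian_tr -mulmxA.
by rewrite -tr_const_mulE XE mulmxA tr_const_laplacian mul0mx mxE.
Qed.

(** The residual [1 - L *m X] is symmetric and killed by [L], so its columns are constant; each sums
    to 1. *)
Lemma laplacian_moore_penrose u s : (L *m X) u s = (u == s)%:R - n%:R^-1.
Proof.
have [X1 _ X3 _] : is_moore_penrose L X := moore_penroseP L.
pose Q : 'M[R]_n := 1%:M - L *m X.
have Qtr : Q^T = Q by rewrite /Q linearB /= trmx1 X3.
have LQ : L *m Q = 0.
  rewrite -[L *m Q]trmxK trmx_mul Qtr laplacian_tr /Q mulmxBl mul1mx X1 subrr.
  exact: trmx0.
have Qc i j k : Q i k = Q j k.
  have : L *m col k Q = 0 by rewrite colE mulmxA LQ mul0mx.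
  by move=> /ker_laplacian_const/(_ i j); rewrite !mxE.
have : \sum_i Q i s = 1.
  rewrite -tr_const_mulE /Q mulmxBr mulmx1 mulmxA tr_const_laplacian mul0mx.
  by rewrite subr0 !mxE.
under eq_bigr => i _ do rewrite (Qc i u s).
rewrite sumr_const card_ord -[Q u s *+ n]mulr_natl => E.
have n0 : n%:R != 0 :> R by rewrite pnatr_eq0 -lt0n ltnW.
have -> : n%:R^-1 = Q u s by apply: (mulfI n0); rewrite E divff.
by rewrite /Q !mxE opprB addrC subrK.
Qed.

End Laplacian.

(** * From single columns to the operator norm *)

Lemma l1norm_col_moore_penrose_le (R : realType) (n : nat) (e : rel 'I_n)
    (alpha := vertex_expansion e R) (dmax : R := (max_deg e)%:R) s :
  symmetric e -> irreflexive e -> (2 < n)%N -> 0 < alpha ->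
  \sum_u `|moore_penrose (laplacian e R) u s| <=
    4 * ln (n%:R / 2) * (alpha * ln (2 * dmax / (2 * dmax - alpha)))^-1.
Proof.
move=> e_sym e_irr n2 a0; have n1 : (1 < n)%N := ltnW n2.
have n0 : 0 < n%:R :> R by rewrite ltr0n ltnW.
set X := moore_penrose _.
pose x := col s X; pose y : 'I_n -> R := fun u => x u 0.
have yX u : X u s = y u by rewrite /y mxE.
have y0 : \sum_u y u = 0.
  rewrite -[RHS](sum_col_moore_penrose R e_sym e_irr s); apply: eq_bigr => u _.
  by rewrite yX.
under eq_bigr => u _ do rewrite yX.
rewrite (sum_norm_excess y0).
have flowE (S : {set 'I_n}) : net_flow e y S = (s \in S)%:R - #|S|%:R / n%:R.
  rewrite [LHS]net_flow_laplacian //.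
  under eq_bigr => u _ do
    rewrite /x colE mulmxA -colE mxE laplacian_moore_penrose //.
  rewrite sumrB sumr_const mulr_natl; congr (_ - _).
  rewrite big_mkcond (bigD1 s) //= big1 ?addr0 => [|u /negPf ->].
    by rewrite eqxx; case: ifP.
  by case: ifP.
suff : excess y 0 <=
    2 * ln (n%:R / 2) * (alpha * ln (2 * dmax / (2 * dmax - alpha)))^-1 by lra.
have [pos|pos] := leqP #|[set u | 0 < y u]|.*2 n.
  apply: excess0_le => // S _; rewrite flowE lerD2r.
  by case: (s \in S); rewrite ?ler01.
rewrite -(excessN y0); apply: excess0_le => //.
  (* The flow of [- y] is at most [#|S| / n], hence at most [1 / 2], hence at most
     [1 - #|S| / n]. *)
  move=> S Sn; rewrite net_flowN flowE.
  have : #|S|%:R / n%:R <= 1 / 2 :> R.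
    rewrite ler_pdivrMr //; have : #|S|.*2%:R <= n%:R :> R by rewrite ler_nat.
    by rewrite -muln2 natrM; lra.
  by have : 0 <= (s \in S)%:R :> R := ler0n _ _; lra.
have : (#|[set u | (0 < y u)%R]| + #|[set u | (0 < - y u)%R]| <= n)%N.
  rewrite -cardsUI (_ : _ :&: _ = finset.set0) ?cards0 ?addn0.
    by rewrite -[leqRHS]card_ord max_card.
  by apply/setP => u; rewrite !inE; apply/negbTE; lra.
move: pos; clear; lia.
Qed.

Lemma opnorm11_le (R : realType) (m n : nat) (M : 'M[R]_(m, n)) (C : R) :
  (0 < n)%N -> (forall j, \sum_i `|M i j| <= C) -> opnorm11 M <= C.
Proof.
(* The supremum bound asks for a nonempty set of quotients; [0 < n] makes the all-ones vector
   nonzero. *)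
move=> n0 MC; apply: ge_sup.
  exists (l1norm (M *m const_mx 1) / l1norm (const_mx 1 : 'cV_n)).
  exists (const_mx 1) => //=.
  apply/matrix0Pn; exists (Ordinal n0), 0; rewrite mxE; exact: oner_neq0.
move=> _ [x x0 <-]; rewrite ler_pdivrMr ?l1norm_gt0 // /l1norm mulr_sumr.
apply: (@le_trans _ _ (\sum_i \sum_j `|M i j| * `|x j 0|)).
  apply: ler_sum => i _; rewrite mxE (le_trans (ler_norm_sum _ _ _)) //.
  by apply: ler_sum => j _; rewrite normrM.
rewrite exchange_big; apply: ler_sum => j _.
by rewrite -mulr_suml ler_wpM2r.
Qed.

Theorem theorem7 (R : realType) (n : nat) (hn : (2 <= n)%N) (hn2 : n != 2%N)
    (e : rel 'I_n) (e_sym : symmetric e) (e_irr : irreflexive e)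
    (alpha_gt0 : 0 < vertex_expansion e R) :
  let alpha : R := vertex_expansion e R in
  let dmax : R := (max_deg e)%:R in
  opnorm11 (moore_penrose (laplacian e R)) <=
    (4 * ln (n%:R / 2)) *
    (alpha * ln ((2 * dmax) / (2 * dmax - alpha)))^-1.
Proof.
rewrite /=; apply: opnorm11_le => [|s]; first exact: ltnW.
by apply: l1norm_col_moore_penrose_le => //; rewrite ltn_neqAle eq_sym hn2.
Qed.
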